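(* Let $Z$ be a reflexive Banach space with a semi-normalized basis $(z_i)_{i\in\mathbb{N}}$, and let $(x_i,f_i)_{i\in\mathbb{N}}$ be a frame of an infinite dimensional Banach space $X$ with associated space $Z$ (with basis $(z_i)$). Then $(x_i,f_i)$ cannot have the NQP with respect to $Z$.
   Context: All Banach spaces are real; ''basis'' means Schauder basis; semi-normalized means $0<\inf_i\|z_i\|\le\sup_i\|z_i\|<\infty$. A sequence $(x_i,f_i)_{i\in\mathbb{N}}$, $x_i\in X$, $f_i\in X^*$, is a (Schauder) frame of $X$ if $x=\sum_{i=1}^\infty f_i(x)x_i$ in norm for every $x\in X$. A Banach space $Z$ with basis $(z_i)$ is associated to the frame if $S:Z\to X$, $\sum a_iz_i\mapsto\sum a_ix_i$, and $T:X\to Z$, $x\mapsto\sum_{x_i\ne0}f_i(x)z_i$, are well-defined bounded operators. The frame has the NQP with respect to an associated space $(Z,(z_i))$ if there are $\varepsilon,\delta>0$ and $C\ge1$ such that for all $x\in X$ there is a finitely supported $(k_i)\subset\mathbb{Z}$ with $\|\sum k_i\delta z_i\|_Z\le C\|x\|$ and $\|x-\sum\delta k_ix_i\|_X\le\varepsilon$. *)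

(* Defs.v *)
From HB Require Import structures.
From mathcomp Require Import all_boot all_order all_algebra finmap.
From mathcomp Require Import all_classical all_reals all_analysis.

Set Implicit Arguments.
Unset Strict Implicit.
Unset Printing Implicit Defensive.

Import Order.TTheory GRing.Theory Num.Theory.
Import numFieldNormedType.Exports.

Local Open Scope classical_set_scope.
Local Open Scope ring_scope.

Definition bounded_operator (R : realType) (V W : normedModType R)
  (f : V -> W) := exists M : R, forall x, `|f x| <= M * `|x|.

Section Dual.
Variables (R : realType) (V : normedModType R).

Definition dual_pred : {pred (V -> R^o)} :=
  fun f => `[< linear f /\ bounded_operator f >].

Lemma dual_predP (f : V -> R^o) :
  reflect (linear f /\ bounded_operator f) (f \in dual_pred).
Proof. exact: asboolP. Qed.

Lemma dual_pred_submod_closed : subsemimod_closed dual_pred.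
Proof.
split; first split.
- apply/dual_predP; split; first by move=> a x y; rewrite scaler0 addr0.
  by exists 0 => x; rewrite normr0 mul0r.
- move=> f g /dual_predP[lf [M fM]] /dual_predP[lg [N gN]].
  apply/dual_predP; split.
    by move=> a x y; rewrite /= !fctE lf lg scalerDr addrACA.
  exists (M + N) => x; rewrite !fctE mulrDl.
  by rewrite (le_trans (ler_normD _ _))// lerD.
- move=> k f /dual_predP[lf [M fM]]; apply/dual_predP; split.
    by move=> a x y; rewrite !fctE lf scalerDr !scalerA mulrC.
  exists (`|k| * M) => x.
  by rewrite !fctE normrZ -mulrA ler_wpM2l.
Qed.

HB.instance Definition _ :=
  GRing.isSubmodClosed.Build R (V -> R^o) dual_pred dual_pred_submod_closed.

Record dual := Dual {
  dual_fun :> V -> R^o;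
  dual_funP : dual_fun \in dual_pred }.

HB.instance Definition _ := [isSub for dual_fun].
HB.instance Definition _ := [Choice of dual by <:].
HB.instance Definition _ := [SubChoice_isSubLmodule of dual by <:].

Lemma dual_linear (f : dual) : linear f.
Proof. by case/dual_predP: (dual_funP f). Qed.

HB.instance Definition _ (f : dual) :=
  GRing.isLinear.Build R V R^o *:%R (dual_fun f) (dual_linear f).

Lemma dual_bounded (f : dual) : bounded_operator f.
Proof. by case/dual_predP: (dual_funP f). Qed.

Lemma dualDE (f g : dual) x : (f + g) x = f x + g x.
Proof. by []. Qed.

Lemma dualZE (a : R) (f : dual) x : (a *: f) x = a * f x.
Proof. by []. Qed.

Definition dual_norm (f : dual) : R :=
  sup [set `|f x| | x in [set x : V | `|x| <= 1]].

Lemma dual_norm_has_sup (f : dual) :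
  has_sup [set `|f x| | x in [set x : V | `|x| <= 1]].
Proof.
split; first by exists `|f 0|; exists 0 => //=; rewrite normr0.
have [M fM] := dual_bounded f; exists `|M| => _ [x /= x1 <-].
rewrite (le_trans (fM x))// (le_trans (ler_norm _))// normrM normr_id.
by rewrite ler_piMr.
Qed.

Lemma ler_dual_norm (f : dual) x : `|f x| <= dual_norm f * `|x|.
Proof.
have [->|x0] := eqVneq x 0; first by rewrite linear0 !normr0 mulr0.
have nx : 0 < `|x| by rewrite normr_gt0.
rewrite -ler_pdivrMr// -[X in _ / X]gtr0_norm// -normf_div.
apply: ub_le_sup; first by case: (dual_norm_has_sup f).
exists (`|x|^-1 *: x); first by rewrite /= normrZ normfV normr_id mulVf ?gt_eqF.
by rewrite linearZ /= mulrC.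
Qed.

Lemma dual_norm_le (f : dual) M :
  (forall x, `|x| <= 1 -> `|f x| <= M) -> dual_norm f <= M.
Proof.
move=> fM; apply: ge_sup; first by case: (dual_norm_has_sup f).
by move=> _ [x /= x1 <-]; exact: fM.
Qed.

Lemma ler_dual_norm1 (f : dual) x : `|x| <= 1 -> `|f x| <= dual_norm f.
Proof.
move=> x1; apply: ub_le_sup; first by case: (dual_norm_has_sup f).
by exists x.
Qed.

Lemma dual_normD (f g : dual) : dual_norm (f + g) <= dual_norm f + dual_norm g.
Proof.
apply: dual_norm_le => x x1; rewrite dualDE (le_trans (ler_normD _ _))//.
by rewrite lerD// ler_dual_norm1.
Qed.

Lemma dual_norm_ge0 (f : dual) : 0 <= dual_norm f.
Proof. by rewrite (le_trans (normr_ge0 (f 0)))// ler_dual_norm1// normr0. Qed.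

Lemma dual_normZ (a : R) (f : dual) : dual_norm (a *: f) = `|a| * dual_norm f.
Proof.
have le_normZ b g : dual_norm (b *: g) <= `|b| * dual_norm g.
  apply: dual_norm_le => x x1.
  by rewrite dualZE normrM ler_wpM2l// ler_dual_norm1.
apply/eqP; rewrite eq_le le_normZ /=.
have [->|a0] := eqVneq a 0; first by rewrite normr0 mul0r dual_norm_ge0.
rewrite -ler_pdivlMl ?normr_gt0// -normfV.
by rewrite -[X in dual_norm X <= _](scalerK a0) le_normZ.
Qed.

Lemma dual_norm0_eq0 (f : dual) : dual_norm f = 0 -> f = 0.
Proof.
move=> f0; apply/val_inj/funext => x /=.
by apply/eqP; rewrite -normr_le0 (le_trans (ler_dual_norm f x))// f0 mul0r.
Qed.

HB.instance Definition _ :=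
  Lmodule_isNormed.Build R dual dual_normD dual_normZ dual_norm0_eq0.

Lemma normr_dualE (f : dual) : `|f| = dual_norm f.
Proof. by []. Qed.

End Dual.

Section Reflexive.
Variables (R : realType) (V : normedModType R).

Lemma bidual_subproof (v : V) :
  (fun f : dual V => f v) \in @dual_pred R (dual V).
Proof.
apply/dual_predP; split; first by [].
by exists `|v| => f; rewrite mulrC; exact: ler_dual_norm.
Qed.

(* The canonical embedding of V into its bidual. *)
Definition bidual (v : V) : dual (dual V) := Dual (bidual_subproof v).

Definition reflexive_space := range bidual = [set: dual (dual V)].

End Reflexive.

Section Bases.
Variables (R : realType) (V : normedModType R).

Definition infinite_dimensional :=
  ~ exists (n : nat) (e : 'I_n -> V),
      forall v, exists a : 'I_n -> R, v = \sum_i a i *: e i.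

Definition sums_to (u : nat -> V) (v : V) := series u @ \oo --> v.

Definition schauder_basis (z : nat -> V) :=
  forall v, exists! a : nat -> R, sums_to (fun i => a i *: z i) v.

Definition semi_normalized (z : nat -> V) :=
  (0 < ereal_inf (range (fun i => `|z i|%:E)) /\
   ereal_sup (range (fun i => `|z i|%:E)) < +oo)%E.

Definition frame (x : nat -> V) (f : nat -> dual V) :=
  forall v, sums_to (fun i => f i v *: x i) v.

End Bases.

Section Association.
Variables (R : realType) (X Z : normedModType R).
Variables (x : nat -> X) (f : nat -> dual X) (z : nat -> Z).

(* S is well defined as z is a basis: each w in Z is the sum of a unique series
   of the z i. *)
Definition associated :=
  (exists S : {linear Z -> X}, bounded_operator S /\
     forall (a : nat -> R) (w : Z),
       sums_to (fun i => a i *: z i) w -> sums_to (fun i => a i *: x i) (S w)) /\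
  (exists T : {linear X -> Z}, bounded_operator T /\
     forall v : X,
       sums_to (fun i => if x i != 0 then f i v *: z i else 0) (T v)).

Definition NQP :=
  exists eps delta C : R, [/\ 0 < eps, 0 < delta, 1 <= C &
    forall v : X, exists k : {fsfun nat -> int with 0},
      `|\sum_(i <- finsupp k) ((k i)%:~R * delta) *: z i| <= C * `|v| /\
      `|v - \sum_(i <- finsupp k) ((k i)%:~R * delta) *: x i| <= eps].

End Association.

(* Main.v *)
(** Let K be the set of integer combinations of the delta z_i whose norm in the
bidual of Z is at most 2 eps C.  It is countable, and it is weakly compact: in
the reflexive space Z an ultralimit of points of K is again a vector w, its
coordinates are integer multiples of delta, and as they multiply a
semi-normalized sequence to give a convergent series, almost all of them vanish.
Hence every functional g on X attains its maximum p(g) over S(K), and the NQP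
makes p an equivalent norm on the dual of X.  So S(K) is a countable James
boundary, which is impossible in infinite dimension (Lindenstrauss-Phelps):
enumerating S(K) as d_0, d_1, ..., one perturbs unit vectors g_0, g_1, ... of p
successively by functionals vanishing at the points used so far, in such a way
that their weak limit G satisfies |G(d_n)| < 1 for every n although the
supremum of the |G(d_n)| is 1. *)
Require Import Defs.
From mathcomp Require Import all_boot all_order all_algebra finmap.
From mathcomp Require Import all_classical all_reals all_analysis.
From mathcomp Require Import ring lra.

Set Implicit Arguments.
Unset Strict Implicit.
Unset Printing Implicit Defensive.

Import Order.TTheory GRing.Theory Num.Theory.
Import numFieldNormedType.Exports.

Local Open Scope classical_set_scope.
Local Open Scope ring_scope.

(** * Limits along filters and ultrafilters *)

Lemma cvg_norm_le (T : Type) (R : realType) (V : normedModType R)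
    (F : set_system T) {FF : ProperFilter F} (u : T -> V) (l : V) (M : R) :
  u @ F --> l -> (\forall t \near F, `|u t| <= M) -> `|l| <= M.
Proof.
move=> /(cvg_norm (FF := _)) ul uM.
exact: (closed_cvg _ (@closed_le _ M) uM _ ul).
Qed.

Lemma cvg_norm_ge (T : Type) (R : realType) (V : normedModType R)
    (F : set_system T) {FF : ProperFilter F} (u : T -> V) (l : V) (M : R) :
  u @ F --> l -> (\forall t \near F, M <= `|u t|) -> M <= `|l|.
Proof.
move=> /(cvg_norm (FF := _)) ul uM.
exact: (closed_cvg _ (@closed_ge _ M) uM _ ul).
Qed.

Section Ultralimit.
Variables (T : Type) (R : realType) (U : set_system T).
Hypothesis UU : UltraFilter U.

(** By compactness [u @ U] has a cluster point in the segment from [- M] to [M], and an ultrafilter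
    converges to each of its cluster points. *)
Lemma ultrafilter_bounded_cvg (u : T -> R) (M : R) :
  (forall t, `|u t| <= M) -> exists l : R, u @ U --> l.
Proof.
move=> uM.
have uI : (u @ U) `[- M, M]%classic.
  by apply: (@nearW _ U) => t /=; rewrite in_itv /= -ler_norml.
have [l [_ cl]] := @segment_compact R (- M) M (u @ U) _ uI.
exists l => B Bl /=; have [//|UB] := in_ultra_setVsetC (u @^-1` B) UU.
by have [t []] := cl (~` B) B UB Bl.
Qed.

(** A form of Banach-Alaoglu, the source of both weak limits below: pointwise limits along [U] stay
    linear and keep the bound [M]. *)
Lemma dual_ultralimit (V : normedModType R) (phi : T -> dual V) (M : R) :
  (forall t, `|phi t| <= M) ->
  exists Phi : dual V, `|Phi| <= M /\ forall v, phi t v @[t --> U] --> Phi v.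
Proof.
move=> phiM.
have phiv t v : `|phi t v| <= M * `|v|.
  by apply: (le_trans (ler_dual_norm (phi t) v)); rewrite ler_wpM2r// -normr_dualE.
have /choice[Phi Phil] v : exists l : R^o, phi t v @[t --> U] --> l.
  exact: (ultrafilter_bounded_cvg (phiv^~ v)).
have PhiM v : `|Phi v| <= M * `|v|.
  by apply: (cvg_norm_le (Phil v)); apply: nearW => t; exact: phiv.
have lP : Phi \in @dual_pred R V.
  apply/dual_predP; split; last by exists M.
  move=> a u v.
  have /cvg_unique := Phil (a *: u + v); apply => //.
  have : a *: phi t u + phi t v @[t --> U] --> a *: Phi u + Phi v.
    by apply: cvgD => //; exact: cvgZl_tmp.
  apply: cvg_trans; apply: near_eq_cvg.
  by apply: nearW => t /=; rewrite linearP.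
exists (Dual lP); split => //; rewrite normr_dualE; apply: dual_norm_le => v v1.
rewrite (le_trans (PhiM v))// ler_piMr//.
have [t _] := filter_ex (@filterT _ U _).
by rewrite (le_trans _ (phiM t)).
Qed.

End Ultralimit.

(** * Finite spans and functionals vanishing on them *)

Section Span.
Variables (R : realType) (V : lmodType R).

Fixpoint in_span (s : seq V) (v : V) : Prop :=
  if s is e :: s' then exists a : R, in_span s' (v - a *: e) else v = 0.

Lemma in_span_sum s v : in_span s v ->
  exists a : 'I_(size s) -> R, v = \sum_i a i *: s`_i.
Proof.
elim: s v => [|e s ih] v /=; first by move=> ->; exists (fun=> 0); rewrite big_ord0.
move=> [c /ih [a va]].
exists (fun i => if unlift ord0 i is Some j then a j else c).
rewrite big_ord_recl unlift_none /= -[LHS](subrK (c *: e)) va addrC.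
by congr (_ + _); apply: eq_bigr => i _; rewrite liftK.
Qed.
End Span.

Lemma infinite_dimensional_notin_span (R : realType) (V : normedModType R) :
  infinite_dimensional V -> forall s : seq V, exists v, ~ in_span s v.
Proof.
move=> infV s; apply: contrapT => /forallNP sV; apply: infV.
exists (size s), (fun i => s`_i) => v.
by apply: in_span_sum; exact: contrapT.
Qed.

(* Functionals take values in [R^o], where [field] and [lra] do not apply; these
lemmas move the arithmetic to [R]. *)
Section DualArith.
Variables (R : realType) (V : normedModType R).
Implicit Types (g h : dual V) (v w : V) (a : R).

Lemma dual_subr g v w : g (v - w) = (g v : R) - (g w : R) :> R.
Proof. exact: linearB. Qed.

Lemma dual_scaler g a v : g (a *: v) = a * (g v : R) :> R.
Proof. exact: linearZ. Qed.

Lemma dual_sumr g (I : Type) (r : seq I) (F : I -> V) :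
  g (\sum_(i <- r) F i) = \sum_(i <- r) (g (F i) : R) :> R.
Proof. exact: linear_sum. Qed.

Lemma dual_lincombl g h a v : (g + a *: h) v = (g v : R) + a * (h v : R) :> R.
Proof. by []. Qed.

Lemma dual_bound g v : `|g v : R| <= `|g| * `|v|.
Proof. exact: ler_dual_norm. Qed.

End DualArith.

(* Hahn-Banach for finite-dimensional subspaces, where separation of points is
enough. *)
Lemma dual_separates_span (R : realType) (V : normedModType R) :
  (forall v : V, v != 0 -> exists g : dual V, (g v : R) != 0) ->
  forall (s : seq V) v, ~ in_span s v ->
    exists2 g : dual V, (g v : R) != 0 & forall e, e \in s -> g e = 0 :> R.
Proof.
move=> sep; elim=> [|e s ih] v /=.
  by move=> /eqP/sep[g gv]; exists g.
(* If [e] is outside the span of [s], a multiple of [h] corrects [g] so that it vanishes at [e];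
   otherwise vanishing on [s] suffices. *)
move=> sv; have [es|/ih[h he hs]] := pselect (in_span s e); last first.
  have /ih[g gv gs] : ~ in_span s (v - ((h v : R) / (h e : R)) *: e).
    by move=> ?; apply: sv; exists ((h v : R) / (h e : R)).
  exists (g + (- ((g e : R) / (h e : R))) *: h).
    move: gv; rewrite dual_subr dual_scaler dual_lincombl.
    by congr (_ != 0); field.
  move=> w; rewrite inE dual_lincombl => /orP[/eqP->|ws]; first by field.
  by rewrite (gs w)// (hs w)// mulr0 addr0.
have /ih[g gv gs] : ~ in_span s v.
  by move=> vs; apply: sv; exists 0; rewrite scale0r subr0.
exists g => // w; rewrite inE => /orP[/eqP->|/gs//].
have [a ->] := in_span_sum es; rewrite dual_sumr big1// => i _.
by rewrite dual_scaler gs ?mulr0// mem_nth.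
Qed.

(** * Countable norming boundaries in infinite dimension *)

Section CountableBoundary.
Variables (R : realType) (X : normedModType R) (d : nat -> X) (c : R).
Hypothesis infX : infinite_dimensional X.
Hypothesis sep : forall v : X, v != 0 -> exists g : dual X, (g v : R) != 0.
Hypothesis c_gt0 : 0 < c.
Hypothesis d_norming : forall g : dual X, exists n, c * `|g| <= `|g (d n) : R|.
(* [d (a g)] is a point where [g] is maximal on the range of [d]. *)
Variable a : dual X -> nat.
Hypothesis aP : forall (g : dual X) n, `|g (d n) : R| <= `|g (d (a g)) : R|.

Let p (g : dual X) : R := `|g (d (a g)) : R|.

Let p_ge g : c * `|g| <= p g.
Proof. by have [n cg] := d_norming g; rewrite (le_trans cg)// aP. Qed.

Let p_lincomb g h b : p (g + b *: h) <= p g + `|b| * p h.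
Proof.
rewrite /p dual_lincombl (le_trans (ler_normD _ _))//.
by rewrite lerD ?aP// normrM ler_wpM2l// aP.
Qed.

Let pZ b g : p (b *: g) = `|b| * p g.
Proof.
apply/eqP; rewrite eq_le; apply/andP; split.
  by rewrite {1}/p dualZE normrM ler_wpM2l// aP.
by rewrite /p -normrM -dualZE aP.
Qed.

(** Adding [b *: w], where [w] vanishes on [s], keeps the values on [s], while [p] passes
    continuously from at most 1 at [b = 0] to at least 1 at [b = 2 / p w]. *)
Lemma boundary_step g (t : R) (s : seq X) : p g <= 1 -> 0 <= t <= 1 ->
  exists g' : dual X, p g' = 1 /\ forall e, e \in s -> g' e = t * (g e : R) :> R.
Proof.
move=> pg t01.
have [v vs] := infinite_dimensional_notin_span infX s.
have [w wv ws] := dual_separates_span sep vs.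
have pw : 0 < p w.
  rewrite (lt_le_trans _ (p_ge w))// mulr_gt0// normr_gt0.
  by apply: contra wv => /eqP ->.
pose phi (b : R) : R := p (t *: g + b *: w).
have phi_lip b b' : phi b <= phi b' + `|b - b'| * p w.
  have := p_lincomb (t *: g + b' *: w) w (b - b').
  by rewrite -addrA -scalerDl [b' + _]addrC subrK.
have phi_cont : continuous phi.
  move=> b; apply/cvgrPdist_le => e e0; near=> b'.
  have bb' : `|b - b'| * p w <= e.
    rewrite -ler_pdivlMr//; near: b'.
    by apply: cvgr_dist_le; [exact: cvg_id|rewrite divr_gt0].
  rewrite ler_distl lerBlDr; apply/andP; split.
    by rewrite (le_trans (phi_lip b' b))// distrC lerD2l.
  by rewrite (le_trans (phi_lip b b'))// lerD2l.
have [b _ phib] : exists2 b, b \in `[0, 2 / p w] & phi b = 1.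
  have b0 : 0 <= 2 / p w by rewrite divr_ge0// ltW.
  apply: IVT => //; first exact: continuous_subspaceT.
  have phi0 : phi 0 <= 1.
    rewrite /phi scale0r addr0 pZ; case/andP: t01 => t0 t1.
    by rewrite ger0_norm// mulr_ile1// normr_ge0.
  have phi2 : 1 <= phi (2 / p w).
    have := p_lincomb (t *: g + (2 / p w) *: w) (t *: g) (-1).
    rewrite scaleN1r addrAC subrr add0r [p (_ *: w)]pZ normrN1 mul1r -/(phi _).
    rewrite (ger0_norm b0) divfK ?gt_eqF//.
    move=> h; rewrite -(lerD2r 1) (le_trans h)// lerD2l.
    by move: phi0; rewrite /phi scale0r addr0.
  rewrite ge_min le_max; apply/andP; split; apply/orP.
    by left; exact: phi0.
  by right; exact: phi2.
exists (t *: g + b *: w); split => // e es.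
by rewrite dual_lincombl ws// mulr0 addr0.
Unshelve. all: by end_near. Qed.

Let q n : R := 2^-1 ^+ n.

Let q_gt0 n : 0 < q n. Proof. by rewrite exprn_gt0// invr_gt0. Qed.

Let q_le1 n : q n <= 1.
Proof. by rewrite exprn_ile1// ?invr_ge0// invf_le1// ler1n. Qed.

Let qS n : q n = 2 * q n.+1.
Proof. by rewrite /q exprS mulrA mulfV// mul1r. Qed.

Lemma no_countable_norming_boundary : False.
Proof.
have /choice[next nextP] (x : (dual X * seq X) * nat) : exists g' : dual X,
    p x.1.1 <= 1 -> p g' = 1 /\
    forall e, e \in x.1.2 -> g' e = (1 - q x.2.+1) * (x.1.1 e : R) :> R.
  (* The value 0 is a default: the construction only meets inputs with [p x.1.1 = 1]. *)
  have [px|//] := pselect (p x.1.1 <= 1); last by exists 0.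
  have [|g' g'P] := @boundary_step x.1.1 (1 - q x.2.+1) x.1.2 px.
    by rewrite subr_ge0 q_le1/= gerBl ltW.
  by exists g'.
have [g0 [pg0 _]] : exists g' : dual X, p g' = 1 /\
    forall e, e \in [::] -> g' e = 0 * ((0 : dual X) e : R) :> R.
  by apply: boundary_step; rewrite ?lexx ?ler01// /p normr0.
(* The second component of [st n] collects the points whose values are
frozen, up to the factors [1 - q k], from then on. *)
pose fix st n : dual X * seq X := if n is m.+1 then
    let s := [:: d m, d (a (st m).1) & (st m).2] in
    (next (((st m).1, s), m), s) else (g0, [::]).
pose g n := (st n).1; pose s n := (st n).2.
have pg n : p (g n) = 1.
  elim: n => [//|n pgn].
  by have [] := nextP (((st n).1, s n.+1), n); rewrite //= -/(g n) pgn.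
have gS n e : e \in s n.+1 -> g n.+1 e = (1 - q n.+1) * (g n e : R) :> R.
  move=> es; have [|_] := nextP (((st n).1, s n.+1), n); last exact.
  by rewrite /= -/(g n) pg.
have s_incr n m : (n <= m)%N -> {subset s n <= s m}.
  move=> /subnK <-; elim: (m - n)%N => [//|k ih] e /ih es.
  by rewrite /s addSn /= !inE es !orbT.
have gm n m e : e \in s n.+1 -> (n <= m)%N ->
    g m.+1 e = (1 - q m.+1) * (g m e : R) :> R.
  by move=> es nm; apply: gS; exact: s_incr es.
have g_le1 m n : `|g m (d n) : R| <= 1 by rewrite -(pg m) aP.
(* The step at [n] multiplies the value at [d n] by [1 - q n.+1], and the later factors only shrink
   it. *)
have upper n m : (n < m)%N -> `|g m (d n) : R| <= 1 - q n.+1.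
  have ds : d n \in s n.+1 by rewrite /s /= inE eqxx.
  elim: m => [//|m ih]; rewrite ltnS => nm.
  rewrite (gm _ _ _ ds nm) normrM ger0_norm ?subr_ge0//.
  move: nm; rewrite leq_eqVlt => /orP[/eqP <-|/ih h].
    by rewrite ler_piMr// ?subr_ge0.
  by rewrite (le_trans _ h)// ler_piMl// gerBl ltW.
(* The value starts at 1 for [m = n]; being at most 1, it loses at most [q m.+1 = q m - q m.+1] at
   each step. *)
have lower n m : (n <= m)%N -> 1 - q n + q m <= `|g m (d (a (g n))) : R|.
  have ds : d (a (g n)) \in s n.+1 by rewrite /s /= !inE eqxx orbT.
  elim: m => [|m ih].
    by rewrite leqn0 => /eqP ->; rewrite subrK -/(p _) pg.
  rewrite leq_eqVlt => /orP[/eqP <-|nm]; first by rewrite subrK -/(p _) pg.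
  rewrite (gm _ _ _ ds nm) normrM ger0_norm ?subr_ge0//.
  have := ih nm; have := g_le1 m (a (g n)).
  have := q_gt0 m.+1; rewrite (qS m); set x := `|_|; set y := q _ => y0 x1 h.
  rewrite mulrBl mul1r; have : y * x <= y by rewrite ler_piMr// ltW.
  lra.
have [U [UU oU]] := ultraFilterLemma (@eventually_filter : ProperFilter \oo).
have [|G [_ gG]] := @dual_ultralimit _ _ _ UU X g c^-1.
  by move=> n; rewrite -[c^-1]mul1r ler_pdivlMr// mulrC -(pg n).
have G_lt n : `|G (d n) : R| <= 1 - q n.+1.
  apply: (cvg_norm_le (gG (d n))); apply: oU.
  by exists n.+1 => // m /=; exact: upper.
have G_ge n : 1 - q n <= `|G (d (a (g n))) : R|.
  apply: (cvg_norm_ge (gG _)); apply: oU; exists n => // m /= nm.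
  by rewrite (le_trans _ (lower _ _ nm))// lerDl ltW.
(* The maximum of [G], at [d (a G)], is at most [1 - q (a G).+1], yet some point gives at least
   [1 - q (a G).+2], which is larger. *)
have := G_ge (a G).+2; have := aP G (a (g (a G).+2)); have := G_lt (a G).
rewrite (qS (a G).+1); have := q_gt0 (a G).+2; lra.
Qed.

End CountableBoundary.

(** * Schauder bases: bounded partial sums and continuous coordinates *)

Lemma sums_to_delta (R : realType) (V : normedModType R) (z : nat -> V) j :
  sums_to (fun i => (i == j)%:R *: z i) (z j).
Proof.
apply: cvg_near_cst; exists j.+1 => // n /= jn.
rewrite /series /= big_mkord (bigD1 (Ordinal jn))//= eqxx scale1r big1 ?addr0//.
by move=> i ij; rewrite -val_eqE /= in ij; rewrite (negbTE ij) scale0r.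
Qed.

Section BasisCoordinates.
Variables (R : realType) (Z : completeNormedModType R) (z : nat -> Z).
Hypothesis z_neq0 : forall i, z i != 0.
Variable co : Z -> nat -> R.
Hypothesis coP : forall w, sums_to (fun i => co w i *: z i) w.
Hypothesis co_uniq : forall w b, sums_to (fun i => b i *: z i) w -> co w = b.

Let P n w : Z := series (fun i => co w i *: z i) n.

Lemma coord_linear b u v i : co (b *: u + v) i = b * co u i + co v i.
Proof.
rewrite (@co_uniq _ (fun i => b * co u i + co v i))// /sums_to.
rewrite [X in X @ _](_ : _ =
    b \*: series (fun i => co u i *: z i) + series (fun i => co v i *: z i)).
  apply: cvgD; last exact: coP.
  exact: (cvgZl_tmp (@coP u)).
apply/funext => n; rewrite !fctE /series /= scaler_sumr -big_split /=.
by apply: eq_bigr => k _; rewrite scalerDl scalerA.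
Qed.

Let P_linear n b u v : P n (b *: u + v) = b *: P n u + P n v.
Proof.
rewrite /P /series /= scaler_sumr -big_split /=.
by apply: eq_bigr => k _; rewrite coord_linear scalerDl scalerA.
Qed.

Let P0 n : P n 0 = 0.
Proof. by have := P_linear n (-1) 0 0; rewrite !scaleN1r !addNr. Qed.

Let PZ n b u : P n (b *: u) = b *: P n u.
Proof. by have := P_linear n b u 0; rewrite P0 !addr0. Qed.

Let PB n u v : P n (u - v) = P n u - P n v.
Proof. by rewrite addrC -scaleN1r P_linear scaleN1r addrC. Qed.

Let PS n w : co w n *: z n = P n.+1 w - P n w.
Proof. by rewrite /P seriesSB. Qed.

(** Convergent series have bounded partial sums, so the sets [A M] cover [Z] and by Baire some
    closure contains a ball. Differences of approximants of points in that ball, rescaled,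
    approximate any [w]. *)
Lemma partial_sums_bounded_approx : exists2 L : R, 0 < L & forall w (e : R),
  0 < e -> exists a, `|w - a| <= e /\ forall n, `|P n a| <= L * `|w|.
Proof.
pose A (M : nat) := [set w | forall n, `|P n w| <= M%:R].
have [M [D [[x0 xD] DF]]] : exists M, exists D,
    (exists x, open_nbhs x D) /\ D `&` ~` closure (A M) = set0.
  apply: contrapT => /forallNP h.
  have /Baire/(_ setT) : forall M, open (~` closure (A M)) /\ dense (~` closure (A M)).
    move=> M; split; first exact/closed_openC/closed_closure.
    by apply: contrapT => /denseNE; exact: h.
  case=> [||w [_ wA]]; [by exists 0|exact: openT|].
  have [B [_ wB]] := cvg_seq_bounded (cvgP _ (@coP w)).
  pose M := (Num.truncn (B + 1)).+1.
  apply: (wA M) => //; apply: subset_closure => n.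
  rewrite (le_trans (wB (B + 1) _ n _))// ?ltrDl//.
  by rewrite ltW// truncnS_gt.
have DA : D `<=` closure (A M).
  by move=> u Du; apply: contrapT => uA; have : set0 u by rewrite -DF.
have [r /= r0 rD] : exists2 r : R, 0 < r & ball x0 r `<=` D.
  by have /open_nbhs_nbhs/nbhs_ballP := xD.
have near_A u e : `|u| < r -> 0 < e -> exists2 a, A M a & `|x0 + u - a| < e.
  move=> ur e0; have /DA/(_ (ball (x0 + u) e)): D (x0 + u).
    by apply: rD; rewrite -ball_normE /= opprD addNKr normrN.
  move=> /(_ (nbhsx_ballx _ _ e0))[a [Aa]]; rewrite -ball_normE /= => ?.
  by exists a.
(* With [s = r / (2 * |w|)], [s *: w] has norm [r / 2]; the partial sums of [a1 - a2] are at most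
   [2 * M], and division by [s] gives this constant. Using [M.+1] keeps it positive. *)
exists (4 * M.+1%:R / r); first by rewrite divr_gt0// mulr_gt0.
move=> w e e0; have [->|w0] := eqVneq w 0.
  by exists 0; split=> [|n]; rewrite ?subrr ?P0 !normr0 ?mulr0// ltW.
have nw0 : 0 < `|w| by rewrite normr_gt0.
pose s : R := r / (2 * `|w|).
have s0 : 0 < s by rewrite divr_gt0// mulr_gt0.
have se0 : 0 < s * e / 2 by rewrite divr_gt0// mulr_gt0.
have [|a1 Aa1 h1] := near_A (s *: w) (s * e / 2) _ se0.
  by rewrite normrZ gtr0_norm// /s invfM mulrA divfK ?gt_eqF//; lra.
have [|a2 Aa2 h2] := near_A 0 (s * e / 2) _ se0; first by rewrite normr0.
exists (s^-1 *: (a1 - a2)); split => [|n].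
  rewrite -[w](scalerK (lt0r_neq0 s0)) -scalerBr normrZ gtr0_norm ?invr_gt0//.
  rewrite ler_pdivrMl// (_ : _ - _ = (x0 + s *: w - a1) - (x0 + 0 - a2)).
    by rewrite (le_trans (ler_normB _ _))//; lra.
  by rewrite addr0 !opprB [RHS]addrC !addrA subrK [a2 + _]addrC.
rewrite PZ PB normrZ gtr0_norm ?invr_gt0// ler_pdivrMl//.
rewrite (_ : s * _ = 2 * M.+1%:R); last first.
  by rewrite /s; field; rewrite !gt_eqF.
rewrite (le_trans (ler_normB _ _))//.
by have := Aa1 n; have := Aa2 n; rewrite -natr1; lra.
Qed.

(* The remainders [r k] of the successive approximations tend to 0, while their
partial sums stay close to the partial sums of a series with coefficients [e],
an ultralimit of their coordinates; that series sums to 0, so [e = 0] by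
uniqueness. *)
Lemma basis_constant : exists2 L : R, 0 < L & forall n w, `|P n w| <= L * `|w|.
Proof.
have [L L0 approx] := partial_sums_bounded_approx.
exists (2 * L) => [|n w]; first by rewrite mulr_gt0.
have [->|w0] := eqVneq w 0; first by rewrite P0 !normr0 mulr0.
have nw0 : 0 < `|w| by rewrite normr_gt0.
pose q k : R := 2^-1 ^+ k.
have q_gt0 k : 0 < q k by rewrite exprn_gt0// invr_gt0.
have qS k : q k = 2 * q k.+1 by rewrite /q exprS mulrA mulfV// mul1r.
have /choice[A AP] (x : Z * nat) : exists a, `|x.1 - a| <= `|w| * q x.2.+1 /\
    forall n, `|P n a| <= L * `|x.1|.
  by apply: approx; rewrite mulr_gt0.
pose fix r k := if k is j.+1 then r j - A (r j, j) else w.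
have rq k : `|r k| <= `|w| * q k.
  by case: k => [|k]; [rewrite mulr1|have [] := AP (r k, k)].
(* Telescoping: one step changes [P m] by at most [L * |r j|], hence by at most [L * |w| * q j = 2 *
   L * |w| * (q j - q j.+1)]. *)
have rdist m k l : (k <= l)%N -> `|P m (r k) - P m (r l)| <= 2 * L * `|w| * (q k - q l).
  move=> /subnK <-; elim: (l - k)%N => [|j ih]; first by rewrite !subrr normr0 mulr0.
  rewrite addSn /= PB opprB addrCA addrC; set i := (j + k)%N in ih *.
  rewrite (le_trans (ler_normD _ _))//.
  have [_ /(_ m) /= h] := AP (r i, i).
  have : L * `|r i| <= L * (`|w| * q i) by rewrite ler_wpM2l// ltW.
  by rewrite (qS i) => h'; move: ih; rewrite (qS i); nra.
have rdist2 m k l : (k <= l)%N -> `|P m (r k) - P m (r l)| <= 2 * L * `|w| * q k.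
  move=> /(rdist m) h; rewrite (le_trans h)// ler_wpM2l ?gerBl// ?ltW//.
  by rewrite !mulr_gt0.
have [U [UU oU]] := ultraFilterLemma (@eventually_filter : ProperFilter \oo).
have /choice[e eP] i : exists l : R, co (r k) i @[k --> U] --> l.
  apply: (ultrafilter_bounded_cvg UU (M := (`|P i.+1 w| + `|P i w| +
      4 * L * `|w|) / `|z i|)) => k.
  rewrite ler_pdivlMr ?normr_gt0// -normrZ PS.
  have := rdist2 i.+1 0%N k (leq0n k); have := rdist2 i 0%N k (leq0n k).
  rewrite /q expr0 mulr1 /= => h h'; rewrite (le_trans (ler_normB _ _))//.
  have := lerB_dist (P i.+1 (r k)) (P i.+1 w); rewrite distrC.
  have := lerB_dist (P i (r k)) (P i w); rewrite distrC.
  lra.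
pose E m : Z := series (fun i => e i *: z i) m.
have PE m : P m (r k) @[k --> U] --> E m.
  elim: m => [|m ih]; first by rewrite /P /E /series /= !big_geq//; under eq_cvg do
    rewrite big_geq//; exact: cvg_cst.
  rewrite [E _](_ : _ = E m + e m *: z m); last by rewrite /E /series /= big_nat_recr.
  rewrite [X in X @ _](_ : _ = fun k => P m (r k) + co (r k) m *: z m); last first.
    by apply/funext => k; rewrite /P /series /= big_nat_recr.
  by apply: cvgD => //; exact: cvgZr_tmp.
have PEr m k : `|P m (r k) - E m| <= 2 * L * `|w| * q k.
  apply: (cvg_norm_le (u := fun l => P m (r k) - P m (r l)) (F := U)).
    by apply: cvgB; [exact: cvg_cst|exact: PE].
  by apply: oU; exists k => // l /=; exact: rdist2.
(* The bound [PEr] is uniform in [m]: first fix [k] so that [r k] and [P m (r k) - E m] are small,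
   then let [m] grow so that [P m (r k)] approaches [r k]. *)
have E0 : sums_to (fun i => e i *: z i) 0.
  apply/cvgr0Pnorm_le => eps eps0.
  have [k qk] : exists k, (2 * L + 1) * `|w| * q k <= eps / 2.
    have C0 : 0 < (2 * L + 1) * `|w| by rewrite mulr_gt0// addr_gt0// mulr_gt0.
    have : q @ \oo --> 0 by apply: cvg_expr; rewrite gtr0_norm ?invr_gt0// invf_lt1// ltr1n.
    move=> /cvgr0Pnorm_le/(_ (eps / 2 / ((2 * L + 1) * `|w|))) [].
      by rewrite !divr_gt0.
    move=> k _ /(_ k (leqnn k)) /=; rewrite ler_pdivlMr// mulrC gtr0_norm// => ?.
    by exists k.
  have /cvgrPdist_le/(_ (eps / 2)) := @coP (r k).
  move=> /(_ _)[|N _ NP]; first by rewrite divr_gt0.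
  exists N => // m /NP /=; rewrite -/(P m _) => h.
  rewrite -/(E m); have := PEr m k; have := rq k.
  have := lerB_dist (E m) (P m (r k)); have := lerB_dist (P m (r k)) (r k).
  rewrite (distrC (E m)) (distrC (P m (r k))).
  by move: qk; rewrite mulrDl mul1r mulrDl; lra.
have e0 : e = fun=> 0.
  rewrite -(co_uniq E0); apply/funext => i; have := coord_linear (-1) 0 0 i.
  by rewrite scaler0 addr0 mulN1r addNr.
(* As [r 0 = w] and [E n = 0], the case [k = 0] is the claim. *)
have := PEr n 0%N; rewrite /q expr0 mulr1 /= [E n](_ : _ = 0) ?subr0//.
by rewrite /E e0 /series /= big1// => i _; rewrite scale0r.
Qed.

End BasisCoordinates.

(** The term of index [i] is a difference of two consecutive partial sums, so the basis constant
    bounds each coordinate. *)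
Lemma schauder_coordinates (R : realType) (Z : completeNormedModType R)
    (z : nat -> Z) : schauder_basis z -> (forall i, z i != 0) ->
  exists zeta : nat -> dual Z,
    (forall w, sums_to (fun i => zeta i w *: z i) w) /\
    forall i j, zeta i (z j) = (i == j)%:R :> R.
Proof.
move=> zb z0.
have /choice[co coP] w : exists a : nat -> R,
    sums_to (fun i => a i *: z i) w /\
    forall b, sums_to (fun i => b i *: z i) w -> a = b.
  by have [a [aw au]] := zb w; exists a.
have co1 w := (coP w).1; have co2 w b := (coP w).2 b.
have [L L0 PL] := basis_constant z0 co1 co2.
have zP i : (fun w => co w i : R^o) \in @dual_pred R Z.
  apply/dual_predP; split; first by move=> b u v; exact: coord_linear.
  exists (2 * L / `|z i|) => w.
  rewrite mulrAC ler_pdivlMr ?normr_gt0// -normrZ.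
  rewrite (_ : _ *: _ = series (fun i => co w i *: z i) i.+1 -
    series (fun i => co w i *: z i) i); last by rewrite seriesSB.
  by rewrite (le_trans (ler_normB _ _))// mulrDl mul1r mulrDl lerD.
exists (fun i => Dual (zP i)); split => [w|i j] /=; first exact: co1.
by rewrite (co2 _ _ (@sums_to_delta _ _ z j)).
Qed.

(** * Integer combinations with step [delta] and their weak limits *)

Lemma cvg_int_multiple (R : realType) (T : Type) (F : set_system T)
    {FF : ProperFilter F} (m : T -> int) (delta l : R) :
  0 < delta -> (m t)%:~R * delta @[t --> F] --> l ->
  exists k : int, l = k%:~R * delta.
Proof.
move=> delta0 ml.
(* Two multiples of [delta] this close to [l] differ by less than [delta], so they coincide and [m]
   is eventually constant. *)
have near_l : \forall t \near F, `|l - (m t)%:~R * delta| < delta / 2.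
  by move/cvgrPdist_lt: ml; apply; rewrite divr_gt0.
have [t0 t0l] := filter_ex near_l.
exists (m t0); apply: (cvg_unique _ ml) => //; apply: cvg_near_cst.
apply: filterS near_l => t tl; congr (_%:~R * _); apply/eqP.
rewrite -subr_eq0 -normr_le0 -ltzD1 add0r -(ltr_int R) -(ltr_pM2r delta0).
rewrite intr_norm intrB -[X in _ * X < _]gtr0_norm// -normrM mulrBl mul1r.
move: t0l tl; rewrite !ltr_norml => /andP[? ?] /andP[? ?].
by apply/andP; split; lra.
Qed.

Section Lattice.
Variables (R : realType) (V : normedModType R) (z : nat -> V) (delta : R).

(** Lists of pairs form a countable type, which permits enumeration. An index may repeat; its
    coefficients then add up. *)
Definition lattice_point (s : seq (nat * int)) : V :=
  \sum_(p <- s) (p.2%:~R * delta) *: z p.1.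

Variable zeta : nat -> dual V.
Hypothesis zetaE : forall w, sums_to (fun i => zeta i w *: z i) w.
Hypothesis zeta_delta : forall i j, zeta i (z j) = (i == j)%:R :> R.

Lemma lattice_point_coord s i :
  zeta i (lattice_point s) = (\sum_(p <- s | p.1 == i) p.2)%:~R * delta :> R.
Proof.
rewrite dual_sumr raddf_sum mulr_suml [RHS]big_mkcond /=.
apply: eq_bigr => p _; rewrite dual_scaler zeta_delta eq_sym.
by case: eqP => _; rewrite ?mulr1// mulr0.
Qed.

(** The coordinates of [w] are multiples of [delta]. A nonzero one gives a term of norm at least
    [c * delta], while the terms of a convergent series tend to 0. *)
Lemma lattice_point_weak_limit (T : Type) (F : set_system T)
    {FF : ProperFilter F} (s : T -> seq (nat * int)) (w : V) (c : R) :
  0 < delta -> 0 < c -> (forall i, c <= `|z i|) ->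
  (forall i, zeta i (lattice_point (s t)) @[t --> F] --> zeta i w) ->
  exists s', w = lattice_point s'.
Proof.
move=> delta0 c0 cz sw.
have /choice[k kE] i : exists k : int, zeta i w = k%:~R * delta :> R.
  apply: (cvg_int_multiple (F := F) (m := fun t => \sum_(p <- s t | p.1 == i) p.2)) => //.
  have := sw i; apply: cvg_trans; apply: near_eq_cvg.
  by apply: nearW => t /=; rewrite lattice_point_coord.
have [N _ kN] : \forall i \near \oo, k i = 0.
  have /cvgr0Pnorm_lt/(_ (c * delta)) := cvg_series_cvg_0 (cvgP _ (@zetaE w)).
  move=> /(_ _)[|N _ NP]; first by rewrite mulr_gt0.
  exists N => // i /NP /=; rewrite normrZ => h; apply/eqP.
  rewrite -normr_le0 -ltzD1 add0r -(ltr_int R) -(ltr_pM2r delta0).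
  rewrite intr_norm -[X in _ * X < _]gtr0_norm// -normrM mul1r -(ltr_pM2l c0).
  by rewrite -kE (le_lt_trans _ h)// mulrC ler_wpM2l.
exists [seq (i, k i) | i <- iota 0 N].
rewrite /lattice_point big_map /=; apply: (cvg_unique _ (@zetaE w)) => //.
apply: cvg_near_cst; exists N => // n /= Nn.
rewrite /series /= (big_cat_nat (leq0n N) Nn)//= [X in _ + X]big_nat [X in _ + X]big1 ?addr0.
   by rewrite /index_iota subn0; apply: eq_bigr => i _; rewrite kE.
by move=> i /andP[/kN ki _]; rewrite kE ki mul0r scale0r.
Qed.

End Lattice.

(** * From the NQP to a countable norming boundary *)

Lemma semi_normalized_lbound (R : realType) (V : normedModType R)
    (z : nat -> V) : semi_normalized z ->
  exists2 c : R, 0 < c & forall i, c <= `|z i|.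
Proof.
case=> + _; set e := ereal_inf _ => e0.
have eP i : (e <= `|z i|%:E)%E by apply: ereal_inf_lbound; exists i.
case: e e0 eP => [c c0 eP|_ /(_ 0%N)//|//].
by exists c => // i; rewrite -lee_fin.
Qed.

Lemma bidual_norm_le (R : realType) (V : normedModType R) (v : V) :
  `|bidual v| <= `|v|.
Proof.
rewrite normr_dualE; apply: dual_norm_le => h h1.
by rewrite (le_trans (dual_bound h v))// ler_piMl.
Qed.

Lemma dual_precomp (R : realType) (V W : normedModType R)
    (S : {linear V -> W}) (g : dual W) : bounded_operator S ->
  exists h : dual V, forall v, h v = g (S v).
Proof.
move=> [M SM].
have hP : (fun v => g (S v)) \in @dual_pred R V.
  apply/dual_predP; split; first by move=> b u v; rewrite !linearP.
  exists (`|g| * M) => v; rewrite -mulrA (le_trans (dual_bound _ _))//.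
  by rewrite ler_wpM2l.
by exists (Dual hP).
Qed.

Theorem proposition4p7 (R : realType) (X Z : completeNormedModType R)
    (z : nat -> Z) (x : nat -> X) (f : nat -> dual X)
    (hZ : reflexive_space Z) (hz : schauder_basis z) (hzn : semi_normalized z)
    (hX : infinite_dimensional X) (hf : frame x f) (ha : associated x f z) :
  ~ NQP x z.
Proof.
move=> [eps [delta [C [eps0 delta0 C1 nqp]]]].
have [c c0 cz] := semi_normalized_lbound hzn.
have z0 i : z i != 0 by rewrite -normr_gt0 (lt_le_trans c0).
have [zeta [zetaE zeta_delta]] := schauder_coordinates hz z0.
have [[S [Sb Ssum]] _] := ha.
have Sz i : S (z i) = x i.
  have /Ssum h := @sums_to_delta _ _ z i.
  by apply: (cvg_unique _ h) => //; exact: sums_to_delta.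
have SL s : S (lattice_point z delta s) = lattice_point x delta s.
  by rewrite linear_sum; apply: eq_bigr => p _; rewrite linearZ /= Sz.
pose r := C * (2 * eps).
have r0 : 0 <= r by rewrite mulr_ge0 ?mulr_ge0 ?ltW// (lt_le_trans _ C1).
(* The bidual norm is used because [dual_ultralimit] preserves its bounds. *)
pose inK (w : Z) := `|bidual w| <= r.
(* Codes of anything outside K are sent to [[::]], which represents the point 0 of K. *)
have [sK sK_in sK_surj] : exists2 sK : nat -> seq (nat * int),
    forall n, inK (lattice_point z delta (sK n)) &
    forall s, inK (lattice_point z delta s) -> exists n, sK n = s.
  exists (fun n => if (choice.unpickle n : option (seq (nat * int))) is Some s
    then if inK (lattice_point z delta s) then s else [::] else [::]) => [n|s sP].
    have nilK : inK (lattice_point z delta [::]).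
      by rewrite /inK (le_trans (bidual_norm_le _))// /lattice_point big_nil normr0.
    by case: choice.unpickle => [s|//]; case: ifP.
  by exists (choice.pickle s); rewrite choice.pickleK sP.
pose y n := lattice_point z delta (sK n).
have attained (g : dual X) : exists m, forall n, `|g (S (y n)) : R| <= `|g (S (y m)) : R|.
  have [h hE] := dual_precomp g Sb.
  suff [m mP] : exists m, forall n, `|h (y n) : R| <= `|h (y m) : R|.
    by exists m => n; rewrite -!hE.
  pose A := range (fun n => `|h (y n) : R|).
  have hsA : has_sup A.
    split; first by exists `|h (y 0%N) : R|; exists 0%N.
    exists (r * `|h|) => _ [n _ <-].
    have := dual_bound (bidual (y n)) h; move/le_trans; apply.
    by rewrite ler_wpM2r//; exact: sK_in.
  (* A maximizing sequence in K: by reflexivity its ultralimit comes from some [w] in [Z], again a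
     lattice point of K, where [h] attains the supremum. *)
  have /choice[i iP] k : exists i, sup A - k.+1%:R^-1 < `|h (y i) : R|.
    have [|_ [i _ <-] ?] := @sup_adherent _ _ k.+1%:R^-1 _ hsA; last by exists i.
    by rewrite invr_gt0.
  have [U [UU oU]] := ultraFilterLemma (@eventually_filter : ProperFilter \oo).
  have [|Phi [Phir Philim]] := dual_ultralimit (phi := fun k => bidual (y (i k))) UU (M := r).
    by move=> k; exact: sK_in.
  have [w _ wE] : range (@bidual R Z) Phi by rewrite hZ.
  have wlim (h' : dual Z) : h' (y (i k)) @[k --> U] --> h' w.
    by have := Philim h'; rewrite -wE.
  have [s ws] : exists s, w = lattice_point z delta s.
    apply: (lattice_point_weak_limit zetaE zeta_delta delta0 c0 cz (F := U)
      (s := fun k => sK (i k))) => j.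
    exact: wlim.
  have [m mE] : exists m, sK m = s by apply: sK_surj; rewrite /inK -ws wE.
  exists m => n; rewrite {2}/y mE -ws.
  have : `|h (y n) : R| <= sup A by apply: ub_le_sup; [case: hsA|exists n].
  move/le_trans; apply; apply/ler_addgt0Pr => e e0; rewrite -lerBlDr.
  apply: (cvg_norm_ge (wlim h)); apply: oU.
  have [N _ NP] := near_infty_natSinv_lt (PosNum e0).
  exists N => // k /NP /= ke; rewrite (le_trans _ (ltW (iP k)))//.
  by rewrite lerB// ltW.
have /choice[a aP] := attained.
apply: (@no_countable_norming_boundary R X (fun n => S (y n)) eps hX _ eps0 _ a aP).
  (* The frame functionals separate points: if every [f k v] vanishes, the expansion of [v] sums to
     0. *)
  move=> v; apply: contra_neqP => /forallNP fv.
  apply: (cvg_unique _ (hf v)) => //.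
  apply: cvg_near_cst; near=> n; rewrite /series /= big1// => k _.
  by have /negP/negPn/eqP -> := fv (f k); rewrite scale0r.
move=> g; exists (a g); set p := `|g (S _) : R|.
(* Approximating [(2 * eps) *: v] within [eps] loses only half of [2 * eps * |g|], which leaves
   [eps * |g| <= p]. *)
have : `|g| <= (p + eps * `|g|) / (2 * eps).
  rewrite [leLHS]normr_dualE; apply: dual_norm_le => v v1.
  rewrite ler_pdivlMr ?mulr_gt0//.
  have [k [kC keps]] := nqp ((2 * eps) *: v).
  have [n nk] : exists n, sK n = [seq (i, k i) | i <- finsupp k].
    apply: sK_surj; rewrite /inK (le_trans (bidual_norm_le _))//.
    rewrite /lattice_point big_map (le_trans kC)// normrZ.
    rewrite ler_wpM2l ?(le_trans _ C1)// gtr0_norm ?mulr_gt0//.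
    by rewrite ler_piMr// ltW// mulr_gt0.
  have Syn : `|(2 * eps) *: v - S (y n)| <= eps.
    by rewrite /y nk SL /lattice_point big_map.
  have := aP g n; rewrite -/p => gp.
  have : `|g ((2 * eps) *: v - S (y n)) : R| <= eps * `|g|.
    by rewrite (le_trans (dual_bound _ _))// mulrC ler_wpM2r.
  rewrite dual_subr dual_scaler => h.
  have -> : `|g v : R| * (2 * eps) = `|(2 * eps) * (g v : R)|.
    by rewrite normrM mulrC (gtr0_norm (x := 2 * eps))// mulr_gt0.
  rewrite -[_ * _](subrK (g (S (y n)) : R)) (le_trans (ler_normD _ _))//.
  by rewrite [leRHS]addrC lerD.
by rewrite ler_pdivlMr ?mulr_gt0//; lra.
Unshelve. all: by end_near. Qed.
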